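(* Let $R\subset S$ be an infra-integral FCP extension of rings with $\ell[R,S]=2$. Then $R\subset S$ is a $\Delta$-extension.
   Context: All rings are commutative and unital. For a ring extension $R\subseteq S$, $[R,S]$ denotes the set of all $R$-subalgebras of $S$, ordered by inclusion. The extension is FCP if every chain in $[R,S]$ is finite; the length $\ell[R,S]$ is the supremum of the lengths of chains in $[R,S]$ (a chain with $n+1$ elements having length $n$). It is a $\Delta$-extension if $T+U\in[R,S]$ for all $T,U\in[R,S]$ (equivalently $T+U=TU$, the compositum). It is infra-integral if it is integral and for each $Q\in\mathrm{Spec}(S)$, with $P:=Q\cap R$, the residual field extension $\kappa_R(P)\to\kappa_S(Q)$ is an isomorphism. *)

(* Defs.v *)
From HB Require Import structures.
From mathcomp Require Import all_boot all_order all_algebra.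
From mathcomp Require Import generic_quotient ring_quotient.
From mathcomp Require Import all_classical.

Set Implicit Arguments.
Unset Strict Implicit.
Unset Printing Implicit Defensive.

Import GRing.Theory.

Local Open Scope classical_set_scope.
Local Open Scope quotient_scope.
Local Open Scope ring_scope.

(* An [idomainType] carries a total inverse operation, whereas                *)
(* [{ideal_quot I}] is only a commutative ring: the missing structure is      *)
(* chosen classically on the following alias.                                 *)
Definition prime_quot (R : comNzRingType) (I : prime_idealr R) : Type :=
  {ideal_quot I}.

Section PrimeQuot.
Variables (R : comNzRingType) (I : prime_idealr R).
Local Notation A := (prime_quot I).

HB.instance Definition _ := GRing.ComNzRing.on A.

Definition pquot_unit : {pred A} := fun x => `[< exists y, y * x = 1 >].
Definition pquot_inv (x : A) : A :=
  if pselect (exists y, y * x = 1) is left e then projT1 (cid e) else x.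

Fact pquot_mulVr : {in pquot_unit, left_inverse 1 pquot_inv *%R}.
Proof.
move=> x /asboolP xu; rewrite /pquot_inv; case: pselect => // e.
exact: (projT2 (cid e)).
Qed.

Fact pquot_unitP (x y : A) : y * x = 1 -> x \in pquot_unit.
Proof. by move=> yx; apply/asboolP; exists y. Qed.

Fact pquot_inv_out : {in [predC pquot_unit], pquot_inv =1 id}.
Proof.
move=> x /negP xu; rewrite /pquot_inv; case: pselect => // e.
by exfalso; apply: xu; apply/asboolP.
Qed.

HB.instance Definition _ := GRing.ComNzRing_hasMulInverse.Build A
  pquot_mulVr pquot_unitP pquot_inv_out.

HB.instance Definition _ :=
  GRing.ComUnitRing_isIntegral.Build A (@Quotient.rquot_IdomainAxiom R I).

Definition to_pquot (x : R) : A := \pi_{ideal_quot I} x.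

Fact to_pquot_zmod_morphism : zmod_morphism to_pquot.
Proof. exact: (rmorphB (\pi_{ideal_quot I})). Qed.

Fact to_pquot_monoid_morphism : monoid_morphism to_pquot.
Proof.
by split; [exact: (rmorph1 (\pi_{ideal_quot I}))
          |exact: (rmorphM (\pi_{ideal_quot I}))].
Qed.

HB.instance Definition _ :=
  GRing.isZmodMorphism.Build R A to_pquot to_pquot_zmod_morphism.
HB.instance Definition _ :=
  GRing.isMonoidMorphism.Build R A to_pquot to_pquot_monoid_morphism.

Lemma to_pquot_eq0 (x : R) : (to_pquot x == 0) = (x \in I).
Proof.
rewrite -(rmorph0 to_pquot) /to_pquot -[x in RHS]subr0.
by rewrite Quotient.idealrBE.
Qed.

Definition pquot_repr (x : A) : R := repr (x : {ideal_quot I}).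

Lemma pquot_reprK : cancel pquot_repr to_pquot.
Proof. exact: reprK. Qed.

End PrimeQuot.

Local Notation "x %:F" := (FracField.tofrac x).

Definition residue_field (R : comNzRingType) (P : prime_idealr R) : fieldType :=
  {fraction (prime_quot P)}.

Lemma tofrac_numden (A : idomainType) (z : {fraction A}) :
  z = (\n_(repr z))%:F / (\d_(repr z))%:F.
Proof.
have dn0 : (\d_(repr z))%:F != 0 by rewrite tofrac_eq0 denom_ratioP.
apply: (mulIf dn0); rewrite divfK //.
rewrite -{1}[z]reprK; move: (repr z) dn0 => r _.
transitivity (FracField.mul (\pi_{fraction A} r) (\d_r)%:F) => //.
rewrite !piE; apply/eqmodP; rewrite /= FracField.equivfE /FracField.mulf.
by rewrite !numden_Ratio ?oner_eq0 ?mulf_neq0 ?denom_ratioP ?oner_eq0 // !mulr1 mulrC.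
Qed.

Section Contraction.
Variables (R S : comNzRingType) (f : {rmorphism R -> S}) (Q : prime_idealr S).

Definition contraction : R -> bool := fun x => f x \in Q.

Fact contraction_idealr_closed : idealr_closed contraction.
Proof.
split=> [||a u v]; rewrite /in_mem /= /contraction.
- by rewrite rmorph0 rpred0.
- by rewrite rmorph1 idealr1.
- by move=> uQ vQ; rewrite rmorphD rmorphM rpredD ?idealMr.
Qed.

Fact contraction_prime : prime_idealr_closed contraction.
Proof.
move=> u v; rewrite /in_mem /= /contraction rmorphM.
by rewrite prime_idealrM.
Qed.

HB.instance Definition _ := isIdealr.Build R contraction
  contraction_idealr_closed.
HB.instance Definition _ := isPrimeIdealrClosed.Build R contraction
  contraction_prime.

Definition contracted_ideal : prime_idealr R := contraction.
Local Notation P := contracted_ideal.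

(* The injection R / f^-1(Q) -> S / Q induced by f.                           *)
Definition pquot_map (x : prime_quot P) : prime_quot Q :=
  to_pquot Q (f (pquot_repr x)).

Lemma pquot_mapE (x : R) : pquot_map (to_pquot P x) = to_pquot Q (f x).
Proof.
apply/eqP; rewrite -subr_eq0 -rmorphB -rmorphB to_pquot_eq0.
suff: pquot_repr (to_pquot P x) - x \in P by [].
rewrite -to_pquot_eq0 rmorphB subr_eq0.
by apply/eqP; exact: pquot_reprK.
Qed.

Fact pquot_map_zmod_morphism : zmod_morphism pquot_map.
Proof.
move=> x y; rewrite -[x]pquot_reprK -[y]pquot_reprK -rmorphB !pquot_mapE.
by rewrite !rmorphB.
Qed.

Fact pquot_map_monoid_morphism : monoid_morphism pquot_map.
Proof.
split=> [|x y]; first by rewrite -(rmorph1 (to_pquot P)) pquot_mapE !rmorph1.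
rewrite -[x]pquot_reprK -[y]pquot_reprK -rmorphM !pquot_mapE.
by rewrite !rmorphM.
Qed.

HB.instance Definition _ := GRing.isZmodMorphism.Build _ _ pquot_map
  pquot_map_zmod_morphism.
HB.instance Definition _ := GRing.isMonoidMorphism.Build _ _ pquot_map
  pquot_map_monoid_morphism.

Lemma pquot_map_eq0 (x : prime_quot P) : (pquot_map x == 0) = (x == 0).
Proof. by rewrite -[x]pquot_reprK pquot_mapE !to_pquot_eq0. Qed.

(* The extension of residue fields induced by f: n / d |-> f n / f d.         *)
Definition residue_map (z : residue_field P) : residue_field Q :=
  let r := repr (z : {fraction (prime_quot P)}) in
  (pquot_map \n_r)%:F / (pquot_map \d_r)%:F.

Lemma residue_map_frac (n d : prime_quot P) : d != 0 ->
  residue_map (n%:F / d%:F) = (pquot_map n)%:F / (pquot_map d)%:F.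
Proof.
move=> dn0; rewrite /residue_map /=.
have := tofrac_numden (n%:F / d%:F); move: (repr _) => r.
have rn0 := denom_ratioP r.
move/eqP; rewrite eqr_div ?tofrac_eq0 // -!tofracM tofrac_eq => /eqP e.
apply/eqP; rewrite eqr_div ?tofrac_eq0 ?pquot_map_eq0 //.
by rewrite -!tofracM tofrac_eq -!rmorphM e.
Qed.

Fact residue_map_zmod_morphism : zmod_morphism residue_map.
Proof.
move=> x y; rewrite [x]tofrac_numden [y]tofrac_numden.
move: (repr x) (repr y) => {x y} [[a b] /= bn0] [[c d] /= dn0].
rewrite -mulNr addf_div ?tofrac_eq0 // -tofracN -!tofracM -tofracD.
rewrite !residue_map_frac ?mulf_neq0 //.
rewrite -mulNr addf_div ?tofrac_eq0 ?pquot_map_eq0 //.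
by rewrite rmorphD !rmorphM rmorphN -tofracN -!tofracM -tofracD.
Qed.

Fact residue_map_monoid_morphism : monoid_morphism residue_map.
Proof.
split=> [|x y].
  have := @residue_map_frac 1 1 (oner_neq0 _).
  by rewrite !rmorph1 !divr1.
rewrite [x]tofrac_numden [y]tofrac_numden.
move: (repr x) (repr y) => {x y} [[a b] /= bn0] [[c d] /= dn0].
rewrite mulf_div -!tofracM !residue_map_frac ?mulf_neq0 //.
by rewrite mulf_div -!tofracM -!rmorphM.
Qed.

HB.instance Definition _ := GRing.isZmodMorphism.Build _ _ residue_map
  residue_map_zmod_morphism.
HB.instance Definition _ := GRing.isMonoidMorphism.Build _ _ residue_map
  residue_map_monoid_morphism.

End Contraction.

Arguments residue_map {R S} f Q z.

Section RingExtension.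
Variables (R : comNzRingType) (S : comAlgType R).

(* A ring extension R <= S is a commutative R-algebra whose structure map     *)
(* a |-> a%:A is injective, R being identified with its image.                *)
Definition ring_extension : Prop := injective (in_alg S).

Definition intermediate : set (set S) := [set T | GRing.subalg_closed [in T]].

Definition is_chain (C : set (set S)) : Prop :=
  C `<=` intermediate /\ total_on C subset.

Definition FCP : Prop := forall C, is_chain C -> finite_set C.

Definition chain_lengths : set nat :=
  [set n | exists2 C, is_chain C & (C #= `I_n.+1)%card].

(* l[R, S] = n; it holds for no n when the lengths are unbounded.             *)
Definition extension_length_eq (n : nat) : Prop := supremums chain_lengths n.

Definition set_add (T U : set S) : set S := [set t + u | t in T & u in U].

Definition delta_extension : Prop :=
  forall T U, intermediate T -> intermediate U -> intermediate (set_add T U).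

Definition infra_integral : Prop :=
  integralRange (in_alg S) /\
  forall Q : prime_idealr S, bijective (residue_map (in_alg S) Q).

End RingExtension.

(* Main.v *)
(* Let T, U be incomparable intermediate rings. As l[R,S] = 2, both are minimal
   over R and T is maximal in S. The conductor M = (R : T) is a maximal ideal of
   R, and a prime of S lying over M, having trivial residue extension, provides
   t with T = R + Rt and t^2 in Rt + M. Let N = (R : U) and U = R + Ru. If M is
   not contained in N, then M + N = R and TU = T + U by splitting 1. Otherwise
   R + tU is a ring containing T, hence is T or S; in both cases tu lies in
   T + U. *)

From HB Require Import structures.
Require Import Defs.
From Stdlib Require Import Ring.
From mathcomp Require Import all_boot all_algebra.
From mathcomp Require Import ring_quotient all_classical.

Import GRing.Theory.

Section RingExtensionFacts.
Set Implicit Arguments.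
Unset Strict Implicit.
Local Open Scope classical_set_scope.
Local Open Scope ring_scope.

Variables (R : comNzRingType) (S : comAlgType R).
Implicit Types (T U V : set S) (a b c : R) (x y : S).

Local Notation "a %:S" := (in_alg S a) (at level 2, format "a %:S").
Local Notation Rs := (range (in_alg S)).

(* Stdlib's [ring] matches operations syntactically, while the MathComp
   operations reach S through several coercion paths: [reify] replaces them by
   these fixed convertible copies. *)
Local Definition ring_add (x y : S) : S := x + y.
Local Definition ring_mul (x y : S) : S := x * y.
Local Definition ring_opp (x : S) : S := - x.
Local Definition ring_zero : S := 0.
Local Definition ring_one : S := 1.

Local Lemma stdlib_ring_theory : ring_theory ring_zero ring_one ring_add
  ring_mul (fun x y => ring_add x (ring_opp y)) ring_opp eq.
Proof.
split; [exact: add0r | exact: addrC | exact: addrA | exact: mul1r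
  | exact: mulrC | exact: mulrA | exact: mulrDl | by [] | exact: subrr].
Qed.
Add Ring stdlib_ring : stdlib_ring_theory.

Ltac reify t := lazymatch t with
  | @Algebra.add _ ?x ?y =>
      let x' := reify x in let y' := reify y in constr:(ring_add x' y')
  | @GRing.mul _ ?x ?y =>
      let x' := reify x in let y' := reify y in constr:(ring_mul x' y')
  | @Algebra.opp _ ?x => let x' := reify x in constr:(ring_opp x')
  | @Algebra.zero _ => constr:(ring_zero)
  | @GRing.one _ => constr:(ring_one)
  | _ => constr:(t : S)
  end.
Ltac alg_ring := lazymatch goal with |- @eq _ ?x ?y =>
  let x' := reify x in let y' := reify y in change (@eq S x' y'); ring end.

(** * The structure map, and intermediate rings as subsets of [S] *)

Lemma algD a b : (a + b)%:S = a%:S + b%:S :> S. Proof. exact: rmorphD. Qed.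
Lemma algB a b : (a - b)%:S = a%:S - b%:S :> S. Proof. exact: rmorphB. Qed.
Lemma algN a : (- a)%:S = - a%:S :> S. Proof. exact: rmorphN. Qed.
Lemma algM a b : (a * b)%:S = a%:S * b%:S :> S. Proof. exact: rmorphM. Qed.
Lemma algX a n : (a ^+ n)%:S = a%:S ^+ n :> S. Proof. exact: rmorphXn. Qed.
Lemma alg0 : 0%:S = 0 :> S. Proof. exact: rmorph0. Qed.
Lemma alg1 : 1%:S = 1 :> S. Proof. exact: rmorph1. Qed.

Lemma intermediateP T : intermediate T <->
  [/\ Rs `<=` T, forall x y, T x -> T y -> T (x + y)
         & forall x y, T x -> T y -> T (x * y)].
Proof.
split=> [[T1 TZ TM]|[RT TD TM]].
  have TZD a x y : T x -> T y -> T (a *: x + y).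
    by have := TZ a x y; rewrite !inE; apply.
  move: T1; rewrite inE => T1.
  have T0 : T 0 by rewrite -(addNr 1) -scaleN1r; exact: TZD.
  split=> [_ [a _ <-]|x y Tx Ty|x y Tx Ty].
  - by rewrite in_algE -[_ *: _]addr0; exact: TZD.
  - by rewrite -[x]scale1r; exact: TZD.
  - by have := TM x y; rewrite !inE; apply.
split=> [|a x y|x y]; rewrite !inE.
- by apply: RT; exists 1; rewrite // alg1.
- by move=> Tx Ty; rewrite -mulr_algl; apply: TD => //; apply: TM => //;
    apply: RT; exists a.
- exact: TM.
Qed.

Section Intermediate.
Variables (T : set S) (iT : intermediate T).

Lemma intermediate_base a : T a%:S.
Proof. by have /intermediateP[RT _ _] := iT; apply: RT; exists a. Qed.

Lemma intermediateM x y : T x -> T y -> T (x * y).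
Proof. by have /intermediateP[_ _] := iT; apply. Qed.

Lemma intermediateD x y : T x -> T y -> T (x + y).
Proof. by have /intermediateP[_ + _] := iT; apply. Qed.

Lemma intermediateB x y : T x -> T y -> T (x - y).
Proof.
move=> Tx Ty; apply: intermediateD => //; rewrite -mulN1r.
by rewrite -alg1 -algN; apply: intermediateM => //;
  exact: intermediate_base.
Qed.

Lemma intermediateZ a x : T x -> T (a%:S * x).
Proof. by move=> Tx; apply: intermediateM => //; exact: intermediate_base. Qed.

Lemma intermediate1 : T 1.
Proof. by rewrite -alg1; exact: intermediate_base. Qed.

Lemma intermediate0 : T 0.
Proof. by rewrite -alg0; exact: intermediate_base. Qed.

End Intermediate.

Lemma intermediate_Rs : intermediate Rs.
Proof.
apply/intermediateP; split=> // _ _ [b _ <-] [c _ <-].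
- by exists (b + c); rewrite // algD.
- by exists (b * c); rewrite // algM.
Qed.

Lemma intermediate_setT : intermediate [set: S].
Proof. by apply/intermediateP. Qed.

(** * Rings of the form R + J with J an R-submodule of S *)

Lemma add_baseP (J : set S) x :
  set_add Rs J x <-> exists a, exists2 y, J y & x = a%:S + y.
Proof.
split=> [[_ [a _ <-] [y Jy <-]]|[a [y Jy ->]]]; first by exists a, y.
by exists a%:S; [exists a|exists y].
Qed.

Definition submodule (J : set S) : Prop :=
  [/\ J 0, forall x y, J x -> J y -> J (x + y)
         & forall a x, J x -> J (a%:S * x)].

(** In (a + x)(b + y) the cross terms stay in J by scaling, so only xy needs a hypothesis. Allowing
    xy to fall into R + J covers both [line x] and the sets tU. *)
Lemma intermediate_add_base (J : set S) : submodule J ->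
    (forall x y, J x -> J y -> set_add Rs J (x * y)) ->
  intermediate (set_add Rs J).
Proof.
move=> [J0 JD JZ] JM.
apply/intermediateP; split=> [_ [a _ <-]||].
- by apply/add_baseP; exists a, 0; rewrite ?addr0.
- move=> _ _ /add_baseP[a [x Jx ->]] /add_baseP[b [y Jy ->]].
  apply/add_baseP; exists (a + b), (x + y); first exact: JD.
  by rewrite algD; alg_ring.
- move=> _ _ /add_baseP[a [x Jx ->]] /add_baseP[b [y Jy ->]].
  have /add_baseP[c [z Jz xyE]] := JM _ _ Jx Jy; apply/add_baseP.
  exists (a * b + c), (a%:S * y + b%:S * x + z).
    by apply: (JD) => //; apply: JD; exact: JZ.
  rewrite algD algM; transitivity
    (a%:S * b%:S + (a%:S * y + b%:S * x) + x * y); first by alg_ring.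
  by rewrite xyE; alg_ring.
Qed.

Lemma submodule_scale (J : set S) x : submodule J ->
  submodule [set x * y | y in J].
Proof.
move=> [J0 JD JZ]; split.
- by exists 0; rewrite ?mulr0.
- by move=> _ _ [y Jy <-] [z Jz <-]; exists (y + z); [exact: JD|alg_ring].
- by move=> a _ [y Jy <-]; exists (a%:S * y); [exact: JZ|alg_ring].
Qed.

Lemma submodule_intermediate T : intermediate T -> submodule T.
Proof.
move=> iT; split=> [|x y|a x]; first exact: intermediate0.
  exact: intermediateD.
exact: intermediateZ.
Qed.

(** Here (xy)(xz) = x(yxz) is again in xT. *)
Lemma intermediate_add_scale T x : intermediate T -> T x ->
  intermediate (set_add Rs [set x * y | y in T]).
Proof.
move=> iT Tx; apply: intermediate_add_base.
  exact/submodule_scale/submodule_intermediate.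
move=> _ _ [y Ty <-] [z Tz <-]; apply/add_baseP.
exists 0, (x * (y * (x * z))); last by rewrite alg0; alg_ring.
by exists (y * (x * z)) => //; do 2!apply: intermediateM => //.
Qed.

Definition line x : set S := range (fun a => a%:S * x).

Lemma submodule_line x : submodule (line x).
Proof.
split.
- by exists 0; rewrite // alg0 mul0r.
- by move=> _ _ [a _ <-] [b _ <-]; exists (a + b); rewrite // algD mulrDl.
- by move=> a _ [b _ <-]; exists (a * b); rewrite // algM mulrA.
Qed.

Lemma intermediate_add_line x : set_add Rs (line x) (x * x) ->
  intermediate (set_add Rs (line x)).
Proof.
move=> /add_baseP[a [_ [b _ <-] xxE]].
apply: intermediate_add_base; first exact: submodule_line.
move=> _ _ [c _ <-] [d _ <-]; apply/add_baseP.
exists (c * d * a), ((c * d * b)%:S * x); first by exists (c * d * b).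
transitivity (c%:S * d%:S * (x * x)); first by alg_ring.
by rewrite xxE !algM; alg_ring.
Qed.

Lemma add_line_mem x : set_add Rs (line x) x.
Proof.
apply/add_baseP; exists 0, x; last by rewrite alg0 add0r.
by exists 1; rewrite // alg1 mul1r.
Qed.

(** * Conductors (R : T) and rings minimal over R *)

Definition conductor T : set R := [set a | forall x, T x -> Rs (a%:S * x)].

Section Conductor.
Variables (T : set S) (iT : intermediate T).

Lemma conductor0 : conductor T 0.
Proof. by move=> x _; exists 0; rewrite // alg0 mul0r. Qed.

Lemma conductorD a b : conductor T a -> conductor T b -> conductor T (a + b).
Proof.
move=> Ca Cb x Tx; rewrite algD mulrDl.
by apply: (intermediateD intermediate_Rs); [exact: Ca|exact: Cb].
Qed.

Lemma conductorM a b : conductor T b -> conductor T (a * b).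
Proof.
move=> Cb x Tx; rewrite algM -mulrA.
by apply: (intermediateZ intermediate_Rs); exact: Cb.
Qed.

Lemma conductorN a : conductor T a -> conductor T (- a).
Proof. by rewrite -mulN1r; exact: conductorM. Qed.

(** The conductor is also an ideal of T: (ax)y = a(xy) lies in R for every y in T. *)
Lemma conductor_absorb a x : conductor T a -> T x ->
  exists2 c, conductor T c & a%:S * x = c%:S.
Proof.
move=> Ca Tx; have [c _ cE] := Ca _ Tx; exists c => // y Ty.
by rewrite cE -mulrA; apply: Ca; exact: intermediateM.
Qed.

End Conductor.

(** Inclusions stand for equalities and strictness, since [Rs] lies in every intermediate ring. *)
Definition minimal_over_base T := [/\ intermediate T, ~ T `<=` Rs
  & forall V, intermediate V -> V `<=` T -> V `<=` Rs \/ T `<=` V].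

Lemma not_conductor1 T : minimal_over_base T -> ~ conductor T 1.
Proof.
by move=> [_ nT _] C1; apply: nT => x /C1; rewrite alg1 mul1r.
Qed.

(** The quadratic relation makes R + Rx a ring; it contains x, which is outside R, so minimality
    leaves only T. *)
Lemma minimal_line T x e m : minimal_over_base T -> T x -> ~ Rs x ->
  x * x = e%:S * x + m%:S -> T `<=` set_add Rs (line x).
Proof.
move=> [iT nT mT] Tx nx xxE.
have iV : intermediate (set_add Rs (line x)).
  apply: intermediate_add_line; apply/add_baseP; exists m, (e%:S * x).
    by exists e.
  by rewrite xxE addrC.
have VT : set_add Rs (line x) `<=` T.
  move=> _ /add_baseP[a [_ [b _ <-] ->]].
  apply: (intermediateD iT); first exact: intermediate_base.
  exact: intermediateZ.
have [VR|//] := mT _ iV VT.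
by case: nx; exact/VR/add_line_mem.
Qed.

(** * Integrality and the maximality of the conductor *)

(** The polynomial det(1 - XA) takes the value 1 at 0, so it is 1 plus a multiple of X; evaluate at
    a. *)
Lemma det1_sub_scale n (A : 'M[R]_n) a :
  exists b, \det (1%:M - a *: A) = 1 - a * b.
Proof.
pose q : {poly R} := \det (1%:M - 'X *: map_mx polyC A).
have qE c : q.[c] = \det (1%:M - c *: A).
  rewrite -[q.[c]]/(horner_eval c q) /q -det_map_mx; congr (\det _).
  apply/matrixP => i j; rewrite !mxE -[LHS]/(_.[c]) hornerD hornerN hornerM.
  by rewrite hornerX hornerC -polyC_natr hornerC.
have /factor_theorem[g gE] : root (q - 1) 0.
  by rewrite rootE !hornerE qE scale0r subr0 det1 subrr.
exists (- g.[a]); rewrite -qE mulrN opprK; have -> : q = 1 + g * ('X - 0%:P).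
  by rewrite -gE addrC subrK.
by rewrite !hornerE subr0 mulrC.
Qed.

Lemma horner_algE n (q : {poly R}) x : (size q <= n)%N ->
  (map_poly (in_alg S) q).[x] = \sum_(i < n) (q`_i)%:S * x ^+ i.
Proof.
move=> szq; rewrite (horner_coef_wide _ (leq_trans (size_poly _ _) szq)).
by apply: eq_bigr => i _; rewrite coef_map.
Qed.

(** Division by a monic equation of x leaves a remainder of degree below n, a bound independent of
    [q]. *)
Lemma integral_span x : integralOver (in_alg S) x ->
  exists n, forall q : {poly R}, exists c : 'I_n -> R,
    (map_poly (in_alg S) q).[x] = \sum_(i < n) (c i)%:S * x ^+ i.
Proof.
move=> [p pm px]; exists (size p).-1 => q.
set r := Pdiv.CommonRing.rmodp q p.
exists (fun i : 'I__ => r`_i).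
rewrite (Pdiv.RingMonic.rdivp_eq pm q) -/r rmorphD rmorphM hornerD hornerM.
rewrite (eqP px) mulr0 add0r.
apply: horner_algE; rewrite -ltnS prednK ?size_poly_gt0 ?monic_neq0 //.
by rewrite Pdiv.CommonRing.ltn_rmodp monic_neq0.
Qed.

Lemma intermediate_sum T n (F : 'I_n -> S) : intermediate T ->
  (forall i, T (F i)) -> T (\sum_(i < n) F i).
Proof.
move=> iT TF; apply: (big_ind T) => //; first exact: intermediate0.
exact: intermediateD.
Qed.

Lemma intermediate_polys x :
  intermediate (range (fun q : {poly R} => (map_poly (in_alg S) q).[x])).
Proof.
apply/intermediateP; split=> [_ [a _ <-]||].
- by exists a%:P; rewrite // map_polyC hornerC.
- by move=> _ _ [p _ <-] [q _ <-]; exists (p + q); rewrite // rmorphD hornerD.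
- by move=> _ _ [p _ <-] [q _ <-]; exists (p * q); rewrite // rmorphM hornerM.
Qed.

Lemma intermediateX T x n : intermediate T -> T x -> T (x ^+ n).
Proof.
move=> iT Tx; elim: n => [|n IHn]; first by rewrite expr0; exact: intermediate1.
by rewrite exprS; exact: intermediateM.
Qed.

Lemma intermediate_horner T x (q : {poly R}) : intermediate T -> T x ->
  T (map_poly (in_alg S) q).[x].
Proof.
move=> iT Tx; rewrite (horner_algE x (leqnn _)).
by apply: intermediate_sum => // i; apply: intermediateZ => //;
  exact: intermediateX.
Qed.

(* If a is not in the conductor then T = R + aT, and Nakayama's determinant
   trick on T / R produces an element of 1 + aR that kills T / R. *)
Lemma conductor_maximal T a : integralRange (in_alg S) -> minimal_over_base T ->
  ~ conductor T a -> exists b, conductor T (1 - a * b).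
Proof.
move=> intS [iT nT mT] nCa.
have TaT : T `<=` set_add Rs [set a%:S * y | y in T].
  have [||VR|//] := mT (set_add Rs [set a%:S * y | y in T]).
  - by apply: intermediate_add_scale => //; exact: intermediate_base.
  - move=> _ /add_baseP[b [_ [y Ty <-] ->]].
    apply: (intermediateD iT); first exact: intermediate_base.
    exact: intermediateZ.
  - case: nCa => y Ty; apply: VR; apply/add_baseP.
    by exists 0, (a%:S * y); [exists y|rewrite alg0 add0r].
have /existsNP[x /not_implyP[Tx nx]] := nT.
(* By minimality T = R[x], so integrality of x makes T a finitely generated R-module. *)
have Tx_poly : T `<=` range (fun q : {poly R} => (map_poly (in_alg S) q).[x]).
  have [|VR|//] := mT _ (intermediate_polys x).
  - by move=> _ [q _ <-]; exact: intermediate_horner.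
  - by case: nx; apply: VR; exists 'X; rewrite // map_polyX hornerX.
have [n span_q] := integral_span (intS x).
have span y : T y -> exists c : 'I_n -> R, y = \sum_(i < n) (c i)%:S * x ^+ i.
  by move=> /Tx_poly[q _ <-]; exact: span_q.
(* T = R + aT applied to each generator gives v = r + aAv for the column v of powers of x, that is,
   (1 - aA)v has entries in R. *)
have /choice[r /choice[A rAE]] :
  forall i : 'I_n, exists r, exists c : 'I_n -> R,
    x ^+ i = r%:S + a%:S * \sum_(j < n) (c j)%:S * x ^+ j.
  move=> i; have /TaT/add_baseP[r [_ [y Ty <-] xiE]] := intermediateX i iT Tx.
  by have [c yE] := span _ Ty; exists r, c; rewrite -yE.
pose M : 'M[R]_n := 1%:M - a *: \matrix_(i, j) A i j.
have [b detM] := det1_sub_scale (\matrix_(i, j) A i j) a.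
exists b; rewrite -detM -/M.
pose v : 'cV[S]_n := \col_i x ^+ i.
have Mv : map_mx (in_alg S) M *m v = map_mx (in_alg S) (\col_i r i).
  rewrite map_mxB map_mx1 map_mxZ mulmxBl mul1mx -scalemxAl.
  apply/colP => i; rewrite !mxE {1}rAE -[RHS]addr0 -addrA; congr (_ + _).
  apply/eqP; rewrite subr_eq0; apply/eqP; congr (_ * _).
  by apply: eq_bigr => j _; rewrite !mxE.
(* Multiplying by the adjugate puts det(M) times each generator in R. *)
have detv : (\det M)%:S *: v = map_mx (in_alg S) (\adj M *m \col_i r i).
  by rewrite map_mxM -Mv mulmxA -map_mxM mul_adj_mx map_scalar_mx mul_scalar_mx.
move=> _ /span[c ->]; rewrite mulr_sumr.
apply: (intermediate_sum intermediate_Rs) => i.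
have := congr1 (fun w : 'cV_n => w i 0) detv; rewrite !mxE => detvi.
by rewrite mulrCA detvi; apply: (intermediateZ intermediate_Rs);
  exact: intermediate_base intermediate_Rs _.
Qed.

(** * Primes of S over a prime of R, and the generators of minimal rings that they provide *)

Section LyingOver.
Variable C : set R.
Hypothesis C0 : C 0.
Hypothesis CD : forall a b, C a -> C b -> C (a + b).
Hypothesis CM : forall a b, C b -> C (a * b).
Hypothesis C1 : ~ C 1.
Hypothesis Cprime : forall a b, C (a * b) -> C a \/ C b.
Hypothesis injR : injective (in_alg S).

Definition ideal_over (J : set S) : Prop :=
  [/\ forall x y, J x -> J y -> J (x + y), forall y x, J x -> J (y * x)
    & forall a, J a%:S -> C a].

(** Zorn's lemma gives J; for s outside J, the larger ideal J + Ss must meet R outside C. *)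
Lemma ex_maximal_ideal_over :
  exists J, [/\ J 0, ideal_over J
    & forall s, ~ J s -> exists a, exists2 x, J x & exists2 y,
        a%:S = x + y * s & ~ C a].
Proof.
have [F FP Ftot|J [[JD JM JC] Jmax]] := @Zorn_bigcup S ideal_over.
  split=> [x y [X FX Xx] [Y FY Yy]|y x [X FX Xx]|a [X FX Xa]].
  - have [XY|YX] := Ftot _ _ FX FY; [exists Y => //|exists X => //].
    + by have [YD _ _] := FP _ FY; apply: YD => //; exact: XY.
    + by have [XD _ _] := FP _ FX; apply: XD => //; exact: YX.
  - by exists X => //; have [_ XM _] := FP _ FX; exact: XM.
  - by have [_ _ XC] := FP _ FX; exact: XC.
(* Without 0, J would be empty, and the zero ideal, admissible by injectivity, would be strictly
   larger. *)
have J0 : J 0.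
  apply: contrapT => nJ0; apply: (Jmax [set 0]).
    split=> [x Jx|/(_ 0 erefl)//].
    by case: nJ0; rewrite -(mul0r x); exact: JM.
  split=> [x y -> ->|y x ->|a /= a0]; [exact: addr0|exact: mulr0|].
  by have -> : a = 0 by apply: injR; rewrite alg0; exact: a0.
exists J; split=> // s nJs; apply: contrapT => nex.
apply: (Jmax [set z | exists2 x, J x & exists y, z = x + y * s]).
  split=> [x Jx|Js]; first by exists x => //; exists 0; rewrite mul0r addr0.
  apply: nJs; apply: Js; exists 0 => //; by exists 1; rewrite mul1r add0r.
split.
- move=> _ _ [x Jx [y ->]] [x' Jx' [y' ->]].
  by exists (x + x'); [exact: JD|exists (y + y'); alg_ring].
- move=> z _ [x Jx [y ->]].
  by exists (z * x); [exact: JM|exists (z * y); alg_ring].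
- move=> a [x Jx [y aE]]; apply: contrapT => nCa; apply: nex.
  by exists a, x => //; exists y.
Qed.

(** An ideal maximal among those contracting into C is prime, and integrality forces its contraction
    to be all of C. *)
Lemma prime_over_integral : integralRange (in_alg S) ->
  exists Q : prime_idealr S, forall a, (a%:S \in Q) <-> C a.
Proof.
move=> intS; have [I [I0 [ID IM IC] Imax]] := ex_maximal_ideal_over.
have Iprime x y : I (x * y) -> I x \/ I y.
  move=> Ixy; apply: contrapT => /not_orP[/Imax[a [u Iu [v aE nCa]]]].
  move=> /Imax[b [u' Iu' [v' bE nCb]]].
  have /IC/Cprime[]// : I (a * b)%:S.
  rewrite algM aE bE.
  have -> : (u + v * x) * (u' + v' * y) =
    (u' + v' * y) * u + (v * x * u' + (v * v') * (x * y)) by alg_ring.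
  by apply: (ID); [exact: IM|apply: ID; exact: IM].
have I1 : ~ I 1 by rewrite -alg1 => /IC.
have IE a : I a%:S <-> C a.
  split=> [|Ca]; first exact: IC.
  (* Otherwise r = x + ya with x in I and r outside C; the equation of y is used to show that r lies
     in C. *)
  apply: contrapT => /Imax[r [x Ix [y rE nCr]]].
  have rayE : r%:S - a%:S * y = x by rewrite rE; alg_ring.
  have [p pm py] := intS y.
  pose n := (size p).-1.
  have szp : size p = n.+1 by rewrite prednK // size_poly_gt0 monic_neq0.
  have pn : p`_n = 1 by apply/eqP; move: pm; rewrite monicE lead_coefE.
  have Cn k : C (r ^+ k) -> C r.
    elim: k => [|k IHk]; first by rewrite expr0.
    by rewrite exprS => /Cprime[].
  (* The equation of y multiplied by a^n becomes a monic equation of ay. *)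
  have p0 : \sum_(i < n.+1) (p`_i * a ^+ (n - i))%:S * (a%:S * y) ^+ i = 0.
    transitivity (a%:S ^+ n * (map_poly (in_alg S) p).[y]); last first.
      by rewrite (eqP py) mulr0.
    rewrite (@horner_algE n.+1) ?szp // mulr_sumr.
    apply: eq_bigr => i _; rewrite algM algX exprMn.
    have -> : a%:S ^+ n = a%:S ^+ (n - i) * a%:S ^+ i :> S.
      by rewrite -exprD subnK // -ltnS.
    by rewrite [X in X * _]mulrC -!mulrA; congr (_ * _); exact: mulrCA.
  (* Modulo I, ay may be replaced by r. Every term with i < n has a factor a in C, hence r^n is in
     C. *)
  have /IC : I (\sum_(i < n.+1) p`_i * a ^+ (n - i) * r ^+ i)%:S.
    have -> : (\sum_(i < n.+1) p`_i * a ^+ (n - i) * r ^+ i)%:S =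
        \sum_(i < n.+1) (p`_i * a ^+ (n - i))%:S *
          (r%:S ^+ i - (a%:S * y) ^+ i).
      rewrite (raddf_sum (in_alg S)) -[LHS]subr0 -[X in _ - X]p0 -sumrB.
      by apply: eq_bigr => i _; rewrite mulrBr -algX -algM.
    apply: (big_ind I) => // i _; apply: (IM).
    by rewrite subrXX rayE mulrC; exact: IM.
  rewrite big_ord_recr /= pn subnn expr0 !mul1r => Csum; apply: nCr.
  apply: (Cn n).
  rewrite -[r ^+ n](addKr (\sum_(i < n) p`_i * a ^+ (n - i) * r ^+ i)).
  apply: CD => //; rewrite -mulN1r; apply: CM.
  apply: (big_ind C) => // i _; rewrite mulrAC; apply: CM.
  rewrite -(prednK (_ : 0 < n - i)%N) ?subn_gt0 // exprSr; exact: CM.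
have Iideal : idealr_closed (fun s => `[< I s >]).
  split=> [||u v w]; [exact/asboolP|by apply/negP => /asboolP|].
  move=> /asboolP Iv /asboolP Iw; apply/asboolP.
  by apply: ID => //; exact: IM.
have Iprimeb : prime_idealr_closed (fun s => `[< I s >]).
  by move=> x y /asboolP /Iprime[Ix|Iy]; apply/orP; [left|right]; exact/asboolP.
pose Q : prime_idealr S := HB.pack_for (prime_idealr S) (fun s => `[< I s >])
  (isIdealr.Build S (fun s => `[< I s >]) Iideal)
  (isPrimeIdealrClosed.Build S (fun s => `[< I s >]) Iprimeb).
exists Q => a; rewrite -IE; split=> [/asboolP//|Ia]; exact/asboolP.
Qed.

End LyingOver.

(* Residually trivial: if Q contracts to C and R / C is a field then R / C is
   the residue field of C, which is therefore all of S / Q. *)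
Lemma infra_integral_complement (C : set R) (Q : prime_idealr S) :
  (forall a, ~ C a -> exists b, C (1 - a * b)) ->
  (forall a, (a%:S \in Q) <-> C a) -> infra_integral S ->
  forall x, exists a, x - a%:S \in Q.
Proof.
move=> Cmax QC [_ /(_ Q) [g _ gK]] x.
(* Surjectivity writes the class of x as n / d with n, d from R; clearing the denominator puts n -
   xd in Q. *)
have := gK (FracField.tofrac (to_pquot Q x)); move: (g _) => z.
rewrite [z]tofrac_numden; move: (repr z) => {z} [[n d] /= dn0].
rewrite residue_map_frac // => zE.
have : pquot_map n = to_pquot Q x * pquot_map d.
  apply/eqP; rewrite -tofrac_eq; apply/eqP; rewrite tofracM -zE divfK //.
  by rewrite tofrac_eq0 pquot_map_eq0.
move: dn0; rewrite -[n]pquot_reprK -[d]pquot_reprK !pquot_mapE to_pquot_eq0.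
move: {zE} (pquot_repr n) (pquot_repr d) => {}n {}d dC.
rewrite -rmorphM => /eqP; rewrite -subr_eq0 -rmorphB to_pquot_eq0 => nxd.
have [b /QC Cdb] : exists b, C (1 - d * b).
  by apply: Cmax => /QC dQ; move/negP: dC; apply.
(* [b] inverts [d] modulo C, so [n * b] represents n / d. *)
exists (n * b).
have -> : x - (n * b)%:S = x * (1 - d * b)%:S - b%:S * (n%:S - x * d%:S).
  by rewrite algB !algM alg1; alg_ring.
by rewrite rpredB ?idealMr.
Qed.

(** Maximal implies prime: if 1 - ac is in the conductor, then so is b = b(1 - ac) + c(ab). *)
Lemma conductor_prime T a b : integralRange (in_alg S) -> minimal_over_base T ->
  conductor T (a * b) -> conductor T a \/ conductor T b.
Proof.
move=> intS mT Cab; apply: contrapT => /not_orP[nCa nCb].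
have [c Cc] := conductor_maximal intS mT nCa.
apply: nCb; have -> : b = b * (1 - a * c) + c * (a * b).
  by rewrite (mulrC c) mulrAC (mulrC _ b) mulrBr mulr1 subrK.
by apply: conductorD; exact: conductorM.
Qed.

(* T = R + Rt with t in Q, so that t is idempotent (e = 1) or square zero
   (e = 0) modulo the conductor: the decomposed and the ramified cases. *)
Lemma minimal_generator T : injective (in_alg S) -> infra_integral S ->
    minimal_over_base T ->
  exists t, [/\ T t, T `<=` set_add Rs (line t)
    & exists e, exists2 m, conductor T m & t * t = e%:S * t + m%:S].
Proof.
move=> injR infra mT; have [intS _] := infra; have [iT nT minT] := mT.
have [Q QC] := prime_over_integral (@conductor0 T) (@conductorD T)
  (@conductorM T) (not_conductor1 mT)
  (fun a b => @conductor_prime T a b intS mT) injR intS.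
have SRQ := infra_integral_complement
  (fun a => @conductor_maximal T a intS mT) QC infra.
have [t [Tt tQ nt]] : exists t, [/\ T t, t \in Q & ~ Rs t].
  have /existsNP[x /not_implyP[Tx nx]] := nT; have [a xaQ] := SRQ x.
  exists (x - a%:S); split=> //.
    by apply: (intermediateB iT) => //; exact: intermediate_base.
  move=> xa; apply: nx; rewrite -(subrK a%:S x).
  by apply: (intermediateD intermediate_Rs) => //; exists a.
(* The ring R + t^2 T is R or T: the first alternative is the ramified case, the second the
   decomposed one. *)
have iV : intermediate (set_add Rs [set t * t * y | y in T]).
  by apply: intermediate_add_scale => //; exact: intermediateM.
have [|VR|TV] := minT _ iV.
- move=> _ /add_baseP[a [_ [y Ty <-] ->]].
  apply: (intermediateD iT); first exact: intermediate_base.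
  by do 2!apply: (intermediateM iT) => //.
- have [m _ mE] : Rs (t * t).
    apply: VR; apply/add_baseP; exists 0, (t * t); last by rewrite alg0 add0r.
    by exists 1; [exact: intermediate1|rewrite mulr1].
  have ttE : t * t = 0%:S * t + m%:S by rewrite mE alg0 mul0r add0r.
  exists t; split=> //; first exact: minimal_line ttE.
  by exists 0, m => //; apply/QC; rewrite mE idealMr.
(* From t = a + t^2 y, a lies in Q, hence in the conductor, and u = ty satisfies u^2 = (t - a)y = u
   - ay: it replaces t as generator. *)
- have /add_baseP[a [_ [y Ty <-] tE]] := TV _ Tt.
  have Ca : conductor T a.
    apply/QC; have -> : a%:S = t - t * t * y by rewrite {1}tE addrK.
    by rewrite rpredB // mulrAC mulrC idealMr // mulrC idealMr.
  have [m Cm mE] := conductor_absorb iT Ca Ty.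
  have uuE : t * y * (t * y) = 1%:S * (t * y) + (- m)%:S.
    rewrite alg1 algN -mE; transitivity ((a%:S + t * t * y) * y - a%:S * y).
      by alg_ring.
    by rewrite -tE; alg_ring.
  have Tu : T (t * y) by exact: intermediateM.
  (* If ty = c were in R, then c would be in the conductor, as a multiple of t, and t = a + ct would
     be in R. *)
  have nu : ~ Rs (t * y).
    move=> [c _ cE]; have Cc : conductor T c.
      by apply/QC; rewrite -/(_%:S) cE mulrC idealMr.
    apply: nt; have -> : t = a%:S + c%:S * t.
      by rewrite [LHS]tE cE; alg_ring.
    apply: (intermediateD intermediate_Rs); first by exists a.
    exact: Cc.
  exists (t * y); split=> //; first exact: minimal_line uuE.
  by exists 1, (- m) => //; exact: conductorN.
Qed.

(** * Consequences of length two *)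

(** Four strictly increasing rings form a chain of length 3. The indexing by [nat] lets explicit
    lists be supplied through [nth]. *)
Lemma no_long_chain (V : nat -> set S) : extension_length_eq S 2 ->
  (forall i, (i < 4)%N -> intermediate (V i)) ->
  (forall i, (i < 3)%N -> V i `<=` V i.+1 /\ ~ V i.+1 `<=` V i) -> False.
Proof.
move=> [len2 _] iV sV.
have mono i j : (i <= j)%N -> (j < 4)%N -> V i `<=` V j.
  elim: j => [|j IHj]; first by rewrite leqn0 => /eqP -> _ x.
  rewrite leq_eqVlt => /predU1P[-> _ x//|ij] j3.
  by apply: subset_trans (IHj ij (ltnW j3)) _; case: (sV j j3).
have lt_neq i j : (i < j)%N -> (j < 4)%N -> V i <> V j.
  move=> ij j4 Vij; have [_] := sV i (leq_trans ij (j4 : (j <= 3)%N)).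
  by apply; rewrite Vij; exact: mono.
suff /len2 : chain_lengths S 3 by [].
exists [set V i | i in `I_4].
  split=> [_ [i /= i4 <-]|_ _ [i /= i4 <-] [j /= j4 <-]]; first exact: iV.
  by case: (leqP i j) => [|/ltnW] ij; [left|right]; exact: mono.
apply: inj_card_eq => i j; rewrite !inE /= => i4 j4 Vij.
by case: (ltngtP i j) => // ij; exfalso;
  [apply: (lt_neq i j)|apply: (lt_neq j i)].
Qed.

Section IncomparablePair.
Variables T U : set S.
Hypothesis len2 : extension_length_eq S 2.
Hypotheses (iT : intermediate T) (iU : intermediate U).
Hypotheses (nTU : ~ T `<=` U) (nUT : ~ U `<=` T).

(** A ring V strictly between would give R < V < T < S, where T < S because U is not inside T. *)
Lemma incomparable_minimal : minimal_over_base T.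
Proof.
split=> // [TR|V iV VT].
  by apply: nTU => x /TR[a _ <-]; exact: intermediate_base.
apply: contrapT => /not_orP[nVR nTV].
apply: (@no_long_chain (nth set0 [:: Rs; V; T; setT]) len2)
  => -[|[|[|[|]]]] //= _.
- exact: intermediate_Rs.
- exact: intermediate_setT.
- by split=> // _ [a _ <-]; exact: intermediate_base.
- by split=> // TT; apply: nUT => x _; exact: TT.
Qed.

(** Otherwise R < T < V < S, where R < T because T is not inside U. *)
Lemma incomparable_maximal V : intermediate V -> T `<=` V ->
  V `<=` T \/ forall x, V x.
Proof.
move=> iV TV; apply: contrapT => /not_orP[nVT nV].
apply: (@no_long_chain (nth set0 [:: Rs; T; V; setT]) len2)
  => -[|[|[|[|]]]] //= _.
- exact: intermediate_Rs.
- exact: intermediate_setT.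
- split=> [_ [a _ <-]|TR]; first exact: intermediate_base.
  by apply: nTU => x /TR[a _ <-]; exact: intermediate_base.
- by split=> // TV'; apply: nV => x; exact: TV'.
Qed.

End IncomparablePair.

(** * Products inside T + U *)

Lemma set_addP T U x :
  set_add T U x <-> exists y z, [/\ T y, U z & x = y + z].
Proof.
split=> [[y Ty [z Uz <-]]|[y [z [Ty Uz ->]]]]; first by exists y, z.
by exists y => //; exists z.
Qed.

Lemma submodule_add T U : intermediate T -> intermediate U ->
  submodule (set_add T U).
Proof.
move=> iT iU; split.
- by apply/set_addP; exists 0, 0; rewrite addr0; split=> //;
    exact: intermediate0.
- move=> _ _ /set_addP[y [z [Ty Uz ->]]] /set_addP[y' [z' [Ty' Uz' ->]]].
  apply/set_addP; exists (y + y'), (z + z'); split; [| |by alg_ring].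
    exact: intermediateD.
  exact: intermediateD.
- move=> a _ /set_addP[y [z [Ty Uz ->]]]; apply/set_addP.
  exists (a%:S * y), (a%:S * z); split; [| |by alg_ring].
    exact: intermediateZ.
  exact: intermediateZ.
Qed.

Lemma add_subl T U x : intermediate U -> T x -> set_add T U x.
Proof.
by move=> iU Tx; apply/set_addP; exists x, 0; rewrite addr0; split=> //;
  exact: intermediate0.
Qed.

Lemma add_subr T U x : intermediate T -> U x -> set_add T U x.
Proof.
by move=> iT Ux; apply/set_addP; exists 0, x; rewrite add0r; split=> //;
  exact: intermediate0.
Qed.

Lemma intermediate_add T U : intermediate T -> intermediate U ->
    (forall x y, T x -> U y -> set_add T U (x * y)) ->
  intermediate (set_add T U).
Proof.
move=> iT iU TU; have [_ addD _] := submodule_add iT iU.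
apply/intermediateP; split=> [_ [a _ <-]||] //.
  by apply: add_subl => //; exact: intermediate_base.
move=> _ _ /set_addP[y [z [Ty Uz ->]]] /set_addP[y' [z' [Ty' Uz' ->]]].
have -> : (y + z) * (y' + z') = (y * y' + z * z') + (y * z' + y' * z).
  by alg_ring.
apply: (addD); apply: addD; [| |exact: TU|exact: TU].
  by apply: add_subl => //; exact: intermediateM.
by apply: add_subr => //; exact: intermediateM.
Qed.

(** In xy = x((1 - a)y) + (ax)y, both (1 - a)y and ax are elements of R. *)
Lemma add_mul_comaximal T U a x y : intermediate T -> intermediate U ->
    conductor T a -> conductor U (1 - a) -> T x -> U y ->
  set_add T U (x * y).
Proof.
move=> iT iU Ca Ca' Tx Uy; have [_ addD _] := submodule_add iT iU.
have -> : x * y = x * ((1 - a)%:S * y) + (a%:S * x) * y.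
  by rewrite algB alg1; alg_ring.
have [b _ <-] := Ca' _ Uy; have [c _ <-] := Ca _ Tx.
apply: addD; last by apply: add_subr => //; exact: intermediateZ.
by apply: add_subl => //; rewrite mulrC; exact: intermediateZ.
Qed.

(* R + tU is a ring because t^2 U = etU + mU and mU lies in R; being above the
   maximal subring T, it is T or S. In the latter case u = a + bt + ctu, where c
   is invertible modulo the conductor since u is not in T. *)
Lemma add_mul_conductor_sub T U : injective (in_alg S) -> infra_integral S ->
    intermediate T -> intermediate U -> minimal_over_base T ->
    minimal_over_base U ->
    (forall V, intermediate V -> T `<=` V -> V `<=` T \/ forall x, V x) ->
    ~ U `<=` T -> conductor T `<=` conductor U ->
  forall x y, T x -> U y -> set_add T U (x * y).
Proof.
move=> injR infra iT iU mT mU maxT nUT CTU.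
have [_ addD addZ] := submodule_add iT iU.
have [t [Tt TE [e [m Cm ttE]]]] := minimal_generator injR infra mT.
have [u [Uu UE _]] := minimal_generator injR infra mU.
suff tU : forall y, U y -> set_add T U (t * y).
  move=> x y /TE/add_baseP[a [_ [b _ <-] ->]] Uy.
  rewrite mulrDl -mulrA; apply: addD; last by apply: addZ; exact: tU.
  by apply: add_subr => //; exact: intermediateZ.
pose V := set_add Rs [set t * y | y in U].
have iV : intermediate V.
  apply: intermediate_add_base.
    exact/submodule_scale/submodule_intermediate.
  move=> _ _ [y Uy <-] [z Uz <-]; apply/add_baseP.
  have Uyz : U (y * z) by exact: intermediateM.
  have [c _ cE] := CTU _ Cm _ Uyz.
  exists c, (t * (e%:S * (y * z))).
    by exists (e%:S * (y * z)) => //; exact: intermediateZ.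
  rewrite cE; transitivity ((t * t) * (y * z)); first by alg_ring.
  by rewrite ttE; alg_ring.
have TV : T `<=` V.
  move=> x /TE/add_baseP[a [_ [b _ <-] ->]]; apply/add_baseP.
  exists a, (t * b%:S); last by rewrite mulrC.
  by exists b%:S => //; exact: intermediate_base.
have [VT|VS] := maxT _ iV TV.
  move=> y Uy; apply: add_subl => //; apply: VT; apply/add_baseP.
  by exists 0, (t * y); [exists y|rewrite alg0 add0r].
suff tu : set_add T U (t * u).
  move=> _ /UE/add_baseP[a [_ [b _ <-] ->]]; rewrite mulrDr mulrCA.
  apply: addD; last exact: addZ.
  by apply: add_subl => //; rewrite mulrC; exact: intermediateZ.
have /add_baseP[a [_ [y Uy <-] uE]] := VS u.
have /UE/add_baseP[b [_ [c _ <-] yE]] := Uy.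
have {}uE : u = a%:S + b%:S * t + c%:S * t * u.
  by rewrite {1}uE yE; alg_ring.
(* dt is again in the conductor of T, hence in that of U, so it multiplies u into R. *)
have CtU d : conductor T d -> exists f, d%:S * t * u = f%:S.
  move=> Cd; have [f /CTU Cf ->] := conductor_absorb iT Cd Tt.
  by have [g _ <-] := Cf _ Uu; exists g.
have Tabt : T (a%:S + b%:S * t).
  apply: (intermediateD iT); first exact: intermediate_base.
  exact: intermediateZ.
(* Otherwise ctu is in R and u = a + bt + ctu is in T, which forces U inside T. *)
have nCc : ~ conductor T c.
  move=> /CtU[f fE]; apply: nUT.
  have Tu : T u.
    by rewrite uE fE; apply: (intermediateD iT) => //; exact: intermediate_base.
  move=> z /UE/add_baseP[g [_ [h _ <-] ->]].
  apply: (intermediateD iT); first exact: intermediate_base.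
  exact: intermediateZ.
have [d Cd] := conductor_maximal infra.1 mT nCc.
have [f fE] := CtU _ Cd.
(* Split tu as d(ctu) + (1 - cd)tu: here ctu = u - (a + bt), and the last term is f in R. *)
have -> : t * u = d%:S * (u - (a%:S + b%:S * t)) + f%:S.
  rewrite -fE; transitivity (d%:S * (c%:S * t * u) + (1 - c * d)%:S * t * u).
    by rewrite algB algM alg1; alg_ring.
  by congr (_ * _ + _); rewrite {2}uE; alg_ring.
apply: addD; last by apply: add_subl => //; exact: intermediate_base.
apply: addZ; apply/set_addP; exists (- (a%:S + b%:S * t)), u.
split=> //; last by rewrite addrC.
by rewrite -sub0r; apply: (intermediateB iT) => //; exact: intermediate0.
Qed.

End RingExtensionFacts.

Theorem theorem4p16 (R : comNzRingType) (S : comAlgType R)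
    (ext : ring_extension S) (infra : infra_integral S) (fcp : FCP S)
    (len2 : extension_length_eq S 2) :
  delta_extension S.
Proof.
move=> T U iT iU; apply: intermediate_add => // x y Tx Uy.
have [TU|nTU] := pselect (subset T U).
  by apply: add_subr => //; apply: intermediateM => //; exact: TU.
have [UT|nUT] := pselect (subset U T).
  by apply: add_subl => //; apply: intermediateM => //; exact: UT.
have mT := incomparable_minimal len2 iT iU nTU nUT.
have mU := incomparable_minimal len2 iU iT nUT nTU.
have [CTU|/existsNP[a /not_implyP[Ca nCa]]] :=
  pselect (subset (conductor T) (conductor U)).
  exact: (add_mul_conductor_sub ext infra iT iU mT mU
    (incomparable_maximal len2 iT iU nTU) nUT CTU).
(* Maximality of the conductor of U makes ab, from the conductor of T, and 1 - ab, from that of U, a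
   splitting of 1. *)
have [b Cb] := conductor_maximal infra.1 mU nCa.
apply: (add_mul_comaximal iT iU _ Cb Tx Uy).
by rewrite mulrC; exact: conductorM.
Qed.
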